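(* Every atomic RCC8 network over $\{\mathbf{PO}\}$ has a convex solution in $\mathbb{R}$.
   Context: A region in $\mathbb{R}^n$ ($n\geq 1$) is a nonempty regular closed subset $X$, i.e. $X=\mathrm{cl}(\mathrm{int}(X))$; write $i(X)$ for the interior. The eight RCC8 base relations between regions $a,b$ (jointly exhaustive and pairwise disjoint; $\subset$ denotes proper inclusion) are: $a\,\mathbf{EQ}\,b$: $a=b$; $a\,\mathbf{DC}\,b$: $a\cap b=\emptyset$; $a\,\mathbf{EC}\,b$: $a\cap b\neq\emptyset$ and $i(a)\cap i(b)=\emptyset$; $a\,\mathbf{PO}\,b$: $i(a)\cap i(b)\neq\emptyset$, $a\not\subseteq b$, $b\not\subseteq a$; $a\,\mathbf{TPP}\,b$: $a\subset b$ and $a\not\subset i(b)$; $a\,\mathbf{NTPP}\,b$: $a\subset i(b)$; and the converses $\mathbf{TPP}^{-1}$, $\mathbf{NTPP}^{-1}$ of the last two. Let $V$ be a finite set of variables. An RCC8 constraint is an expression $u\,R\,v$ with $u,v\in V$ distinct and $R$ a nonempty set of base relations; an RCC8 network is a set of such constraints. It is atomic if for every pair of distinct variables $u,v$ it contains a constraint $u\,R\,v$ or $v\,R\,u$ with $R$ a singleton. It is a network over a set $\mathcal{R}$ of base relations if every constraint $u\,R\,v$ in it has $R\subseteq\mathcal{R}$. An $n$-dimensional solution (solution in $\mathbb{R}^n$) of a network is a map $\mathcal{S}$ from $V$ to regions of $\mathbb{R}^n$ such that for each constraint $u\,R\,v$ the base relation holding between $\mathcal{S}(u)$ and $\mathcal{S}(v)$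 belongs to $R$. A solution is convex if every $\mathcal{S}(v)$ is a convex set. *)

(* Defs.v *)
From mathcomp Require Import all_boot all_order all_algebra.
From mathcomp Require Import all_classical all_reals all_analysis.
Import numFieldNormedType.Exports.

Set Implicit Arguments.
Unset Strict Implicit.
Unset Printing Implicit Defensive.

Local Open Scope classical_set_scope.
Local Open Scope ring_scope.

Inductive rcc8 : Type := EQ | DC | EC | PO | TPP | NTPP | TPPi | NTPPi.

(* `A `<` B` is proper inclusion.  This matters in NTPP and TPP when B is its
   own interior, that is, for regions, when B is the whole space: a region that
   is the whole space is EQ, and not NTPP, to itself. *)
Definition rcc8_holds (T : topologicalType) (r : rcc8) (A B : set T) : Prop :=
  let tpp (X Y : set T) := X `<` Y /\ ~ (X `<` Y°) in
  let ntpp (X Y : set T) := X `<` Y° in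
  match r with
  | EQ => A = B
  | DC => A `&` B = set0
  | EC => A `&` B !=set0 /\ A° `&` B° = set0
  | PO => [/\ A° `&` B° !=set0, ~ (A `<=` B) & ~ (B `<=` A)]
  | TPP => tpp A B
  | NTPP => ntpp A B
  | TPPi => tpp B A
  | NTPPi => ntpp B A
  end.

Definition region (R : realType) (n : nat) (A : set 'rV[R]_n) : Prop :=
  A !=set0 /\ regclosed A.

Record rcc8_constraint (V : finType) : Type := RCC8Constraint {
  clhs : V;
  crhs : V;
  crel : set rcc8;
  clhs_neq_crhs : clhs != crhs;
  crel_neq0 : crel !=set0 }.

Definition rcc8_network (V : finType) : Type := set (rcc8_constraint V).

Definition atomic (V : finType) (N : rcc8_network V) : Prop :=
  forall u v : V, u != v ->
    exists c : rcc8_constraint V,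
      [/\ N c,
          (clhs c = u /\ crhs c = v) \/ (clhs c = v /\ crhs c = u)
        & exists r : rcc8, crel c = [set r]].

Definition network_over (V : finType) (Q : set rcc8) (N : rcc8_network V) :
    Prop :=
  forall c : rcc8_constraint V, N c -> crel c `<=` Q.

(* The base relations are pairwise disjoint on regions of R^n for n >= 1, so
   some base relation in `crel c` holds iff the one that holds is in `crel c`. *)
Definition solution (R : realType) (n : nat) (V : finType)
    (N : rcc8_network V) (S : V -> set 'rV[R]_n) : Prop :=
  (forall v : V, region (S v)) /\
  (forall c : rcc8_constraint V, N c ->
     exists2 r : rcc8, crel c r & rcc8_holds r (S (clhs c)) (S (crhs c))).

Definition convex_solution (R : realType) (n : nat) (V : finType)
    (N : rcc8_network V) (S : V -> set 'rV[R]_n) : Prop :=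
  solution N S /\ forall v : V, convex_set (S v).

(* Main.v *)
(* Equal-radius balls with distinct centers closer than the radius partially
   overlap: each center is interior to both, and moving from one center by the
   radius away from the other one leaves the other ball.  In [R^1], i.e. for
   intervals, distinct centers among [0, ..., #|V| - 1] and radius [#|V| + 1]
   work for all pairs of variables at once. *)
Require Import Defs.
From mathcomp Require Import all_boot all_order all_algebra.
From mathcomp Require Import all_classical all_reals all_analysis.
Import Order.TTheory GRing.Theory Num.Theory numFieldNormedType.Exports.

Local Open Scope classical_set_scope.

Section ClosedBalls.
Local Open Scope ring_scope.
Local Open Scope convex_scope.

Lemma convex_closed_ball (R : realType) (M : normedModType R) (x : M) (r : R) :
  0 < r -> convex_set (closed_ball x r).
Proof.
move=> r0 y z t; rewrite closed_ballE// !inE /closed_ball_/= => xy xz.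
(* The weights sum to 1, so [x] splits along them; the triangle inequality then finishes. *)
have -> : x - (y : convex_lmodType M) <| t |> (z : convex_lmodType M) =
    t%:num *: (x - y) + (1 - t%:num) *: (x - z).
  rewrite !scalerBr addrACA -scalerDl [_ + (1 - _)]addrC subrK.
  by rewrite scale1r -opprD.
rewrite (le_trans (ler_normD _ _))// !normrZ.
have t0 : 0 <= t%:num by [].
have t1 : 0 <= 1 - t%:num by rewrite subr_ge0.
rewrite (ger0_norm t0) (ger0_norm t1).
rewrite (le_trans (lerD (ler_wpM2l t0 xy) (ler_wpM2l t1 xz)))//.
by rewrite -mulrDl addrC subrK mul1r.
Qed.

Lemma closed_ball_eq_center (R : realType) (M : normedModType R) (x y : M)
    (r : R) :
  0 < r -> closed_ball x r `<=` closed_ball y r -> x = y.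
Proof.
move=> r0; rewrite !closed_ballE// => sub; apply: contrapT => /eqP xy.
have d0 : 0 < `|x - y| by rewrite normr_gt0 subr_eq0.
(* Scaling [x - y] by [k] gives it length [r], so [x + k *: (x - y)] is at distance [r] from [x],
   but its distance from [y] exceeds [r] by that between the centers. *)
pose k := r / `|x - y|.
have k0 : 0 < k by rewrite divr_gt0.
have kE : `|k *: (x - y)| = r by rewrite normrZ (gtr0_norm k0) divfK// gt_eqF.
have /sub : closed_ball_ Num.norm x r (x + k *: (x - y)).
  by rewrite /closed_ball_/= opprD addNKr normrN kE.
rewrite /closed_ball_/= distrC addrAC -[X in X + _]scale1r -scalerDl normrZ.
by rewrite gtr0_norm ?addr_gt0// mulrDl mul1r divfK ?gt_eqF// gerDr leNgt d0.
Qed.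

Lemma PO_closed_ball (R : realType) (M : normedModType R) (x y : M) (r : R) :
  x != y -> ball x r y -> rcc8_holds PO (closed_ball x r) (closed_ball y r).
Proof.
move=> xy xry; have r0 : 0 < r.
  by move: xry; rewrite -ball_normE => /le_lt_trans; exact.
split=> [|/(closed_ball_eq_center _ _ _ _ _ r0)/eqP|
  /(closed_ball_eq_center _ _ _ _ _ r0)/esym/eqP]; [|exact/negP..].
rewrite !interior_closed_ballE//; exists x; split; first exact: ballxx.
exact: ball_sym.
Qed.

Lemma ltr_dist_nat (R : realDomainType) (i j m : nat) :
  (i < m)%N -> (j < m)%N -> `|i%:R - j%:R : R| < m%:R.
Proof.
move=> im jm; rewrite ltr_norml ltrBrDl !ltrBlDr -!natrD !ltr_nat.
by rewrite (ltn_addl i jm) (ltn_addr j im).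
Qed.

End ClosedBalls.

Theorem proposition1 (R : realType) (V : finType) (N : rcc8_network V)
    (N_atomic : atomic N) (N_PO : network_over [set PO] N) :
  exists S : V -> set 'rV[R]_1, convex_solution N S.
Proof.
pose x (v : V) : 'rV[R]_1 := const_mx (enum_rank v)%:R%R.
(* The successor keeps the radius positive even when [V] is empty. *)
have r0 : (0 < #|V|.+1%:R :> R)%R by rewrite ltr0Sn.
exists (fun v => closed_ball (x v) #|V|.+1%:R); split; last first.
  by move=> v; exact: convex_closed_ball.
split=> [v|c Nc].
  split; first by exists (x v); exact: closed_ballxx.
  (* A [closed_ball] is by definition the closure of an open ball. *)
  by apply: closure_open_regclosed; exact: ball_open.
have [r cr] := crel_neq0 c; exists r => //.
rewrite (N_PO _ Nc _ cr); apply: PO_closed_ball.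
  apply: contra (clhs_neq_crhs c) => /eqP/matrixP/(_ ord0 ord0).
  by rewrite !mxE => /eqP; rewrite eqr_nat => /eqP/ord_inj/enum_rank_inj ->.
(* Balls of row vectors are given entrywise, so this reduces to two ranks below [#|V|] differing by
   less than the radius. *)
split=> // i j; rewrite !mxE -ball_normE /=.
by apply: ltr_dist_nat; rewrite ltnS ltnW.
Qed.
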